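(* Let $v_1,\dots,v_n\in\mathbb{R}^d$ be vectors with $\sum_{i=1}^n v_i=0$, ordered so that $\|v_1\|\ge\|v_2\|\ge\dots\ge\|v_n\|$, and let $\alpha_1\ge\alpha_2\ge\dots\ge\alpha_n\ge 0$ be real numbers. Let $j\in[n-1]$ and let $\gamma\in[\alpha_{j+1},\alpha_j]$. Then for every permutation $\sigma$ of $[n]$, $$\left\|\sum_{i=1}^n \alpha_i v_{\sigma(i)}\right\|\le \sum_{i=1}^j\alpha_i\|v_i\|-\frac{\gamma}{2}\left[\sum_{i=1}^j\|v_i\|-\sum_{i=j+1}^n\|v_i\|\right].$$
   Context: $[m]=\{1,\dots,m\}$, and $\|\cdot\|$ is the Euclidean norm on $\mathbb{R}^d$. The vectors $v_1,\dots,v_n$ are an indexed family and need not be distinct. *)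

(* Defs.v *)
From mathcomp Require Import all_boot all_order all_algebra all_fingroup.
From mathcomp Require Import reals.

Set Implicit Arguments.
Unset Strict Implicit.
Unset Printing Implicit Defensive.

Import GRing.Theory Num.Theory.
Local Open Scope ring_scope.

(* The norm [`|x|] that MathComp-Analysis puts on matrices is the sup norm,
   hence a separate definition. *)
Definition enorm (R : realType) (d : nat) (x : 'rV[R]_d) : R :=
  Num.sqrt (\sum_(k < d) x 0 k ^+ 2).

(* Families indexed by {1, ..., n} are represented over ['I_n], with the i-th
   member (1-based) at the ordinal of value i - 1.  Accordingly, for
   1 <= j <= n - 1, the j-th and (j+1)-st indices are the ordinals of values
   j.-1 and j, and the range 1 <= i <= j becomes (i < j). *)
Definition ord_jth (n j : nat) (hj : (j < n)%N) : 'I_n :=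
  Ordinal (leq_ltn_trans (leq_pred j) hj).
Definition ord_jth_succ (n j : nat) (hj : (j < n)%N) : 'I_n := Ordinal hj.

(* Main.v *)
Require Import Defs.
From mathcomp Require Import all_boot all_order all_algebra all_fingroup.
From mathcomp Require Import reals.
From mathcomp Require Import ring lra.

Import Order.TTheory GRing.Theory Num.Theory.
Local Open Scope ring_scope.

(** Since the vectors sum to zero, every coefficient [alpha i] may be shifted
    by one and the same constant without changing the vector on the left.
    The shift by [gamma / 2] centres the interval [[0, gamma]], which contains
    the coefficients beyond position [j]: their shifted absolute values are at
    most [gamma / 2], while those of the first [j] coefficients are
    [alpha i - gamma / 2 >= gamma / 2].  The shifted coefficients are thus
    dominated in absolute value by the nonincreasing sequence [beta] equal to
    [alpha i - gamma / 2] up to position [j] and to [gamma / 2] afterwards.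
    The triangle inequality ([enorm_sum_scale_le]) bounds the norm by
    [\sum_i beta i * enorm (v (sigma i))], and as [beta] and the norms are
    sorted the same way, the rearrangement inequality
    ([rearrangement_inequality]) allows [sigma] to be replaced by the identity.
    The resulting sum is the right-hand side. *)

(** * The Euclidean norm *)

(** Lagrange's identity: the two sides differ by half of the sum of the squares
    [(x 0 i * y 0 k - x 0 k * y 0 i) ^+ 2]. *)
Lemma cauchy_schwarz_row (R : realType) (d : nat) (x y : 'rV[R]_d) :
  (\sum_k x 0 k * y 0 k) ^+ 2 <= (\sum_k x 0 k ^+ 2) * (\sum_k y 0 k ^+ 2).
Proof.
set P := \sum_k x 0 k * y 0 k; set S := \sum_k x 0 k ^+ 2.
set T := \sum_k y 0 k ^+ 2.
have lagrange : \sum_i \sum_k (x 0 i * y 0 k - x 0 k * y 0 i) ^+ 2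
    = S * T + S * T - (P * P + P * P).
  rewrite {1}(mulrC S T) !big_distrlr /= -!big_split /= -sumrB.
  apply: eq_bigr => i _; rewrite -!big_split /= -sumrB.
  by apply: eq_bigr => k _; ring.
have : 0 <= \sum_i \sum_k (x 0 i * y 0 k - x 0 k * y 0 i) ^+ 2.
  by apply: sumr_ge0 => i _; apply: sumr_ge0 => k _; apply: sqr_ge0.
by rewrite lagrange expr2; lra.
Qed.

Lemma enorm_ge0 (R : realType) (d : nat) (x : 'rV[R]_d) : 0 <= enorm x.
Proof. exact: sqrtr_ge0. Qed.

Lemma enorm_sqr (R : realType) (d : nat) (x : 'rV[R]_d) :
  enorm x ^+ 2 = \sum_k x 0 k ^+ 2.
Proof. by rewrite sqr_sqrtr // sumr_ge0 // => k _; apply: sqr_ge0. Qed.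

Lemma enorm0 (R : realType) (d : nat) : enorm (0 : 'rV[R]_d) = 0.
Proof.
by rewrite /enorm big1 ?sqrtr0 // => k _; rewrite mxE expr0n.
Qed.

Lemma enormZ (R : realType) (d : nat) (c : R) (x : 'rV[R]_d) :
  enorm (c *: x) = `|c| * enorm x.
Proof.
rewrite /enorm -sqrtr_sqr -sqrtrM ?sqr_ge0 // mulr_sumr.
by congr Num.sqrt; apply: eq_bigr => k _; rewrite mxE exprMn.
Qed.

Lemma enorm_triangle (R : realType) (d : nat) (x y : 'rV[R]_d) :
  enorm (x + y) <= enorm x + enorm y.
Proof.
have nx := enorm_ge0 _ _ x; have ny := enorm_ge0 _ _ y.
rewrite -(@ler_pXn2r _ 2) ?nnegrE ?enorm_ge0 ?addr_ge0 //.
rewrite sqrrD !enorm_sqr.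
have -> : \sum_k (x + y) 0 k ^+ 2
    = \sum_k x 0 k ^+ 2 + (\sum_k x 0 k * y 0 k) *+ 2 + \sum_k y 0 k ^+ 2.
  rewrite -sumrMnl -!big_split /=.
  by apply: eq_bigr => k _; rewrite mxE sqrrD.
rewrite lerD2r lerD2l lerMn2r /=.
apply: le_trans (ler_norm _) _.
rewrite -(@ler_pXn2r _ 2) ?nnegrE ?mulr_ge0 //.
by rewrite real_normK ?num_real // exprMn !enorm_sqr cauchy_schwarz_row.
Qed.

Lemma enorm_sum_scale_le (R : realType) (d : nat) (I : finType)
    (c : I -> R) (w : I -> 'rV[R]_d) :
  enorm (\sum_i c i *: w i) <= \sum_i `|c i| * enorm (w i).
Proof.
elim/big_ind2: _ => [|x1 r1 x2 r2 h1 h2|i _]; first by rewrite enorm0.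
  exact: le_trans (enorm_triangle _ _ _ _) (lerD h1 h2).
by rewrite enormZ.
Qed.

(** * The rearrangement inequality *)

(** A dual solution of the assignment problem with weights [b i * a k]: given
    such a [p] and with [q k = b k * a k - p k], one has
    [b i * a k <= p i + q k], with equality for [i = k].  The function [p]
    is a discrete primitive of [a] with respect to [b]: its increments are
    [(b l.+1 - b l) * a l].  Between [k] and [i] these increments sum to at
    least [(b i - b k) * a k], because [b] decreases and the weight [a l] is at
    most [a k] to the right of [k] and at least [a k] to its left. *)
Lemma assignment_potential (R : realType) (n : nat) (a b : 'I_n -> R)
    (a_sorted : forall i k : 'I_n, (i <= k)%N -> a k <= a i)
    (b_sorted : forall i k : 'I_n, (i <= k)%N -> b k <= b i) :
  exists p : 'I_n -> R, forall i k, (b i - b k) * a k <= p i - p k.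
Proof.
case: n a b a_sorted b_sorted => [|n] a b a_sorted b_sorted.
  by exists (fun=> 0) => -[].
(* Indices in [nat] let the induction below run on the distance between the
   two indices; only values up to [n] matter, where [inord] is faithful. *)
pose A (l : nat) := a (inord l); pose B (l : nat) := b (inord l).
have inord_mono (F : 'I_n.+1 -> R) l m :
    (forall i k : 'I_n.+1, (i <= k)%N -> F k <= F i) ->
    (l <= m)%N -> (m <= n)%N -> F (inord m) <= F (inord l).
  move=> F_sorted lm mn; apply: F_sorted.
  by rewrite !inordK // ltnS (leq_trans lm).
pose p (m : nat) := \sum_(l < m) (B l.+1 - B l) * A l.
have pS m : p m.+1 = p m + (B m.+1 - B m) * A m by rewrite /p big_ord_recr.
have up l r : (l + r <= n)%N -> (B (l + r)%N - B l) * A l <= p (l + r)%N - p l.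
  elim: r => [|r IHr]; first by rewrite addn0 !subrr mul0r.
  rewrite addnS => lrn; rewrite pS.
  have := IHr (ltnW lrn).
  have hA : A (l + r)%N <= A l by apply: inord_mono (leq_addr _ _) (ltnW lrn).
  have hB : B (l + r).+1 <= B (l + r)%N by apply: inord_mono (leqnSn _) lrn.
  have : 0 <= (B (l + r)%N - B (l + r).+1) * (A l - A (l + r)%N).
    by rewrite mulr_ge0 // subr_ge0.
  by lra.
have down l r : (l + r <= n)%N ->
    (B l - B (l + r)%N) * A (l + r)%N <= p l - p (l + r)%N.
  elim: r => [|r IHr]; first by rewrite addn0 !subrr mul0r.
  rewrite addnS => lrn; rewrite pS.
  have := IHr (ltnW lrn).
  have hA : A (l + r).+1 <= A (l + r)%N by apply: inord_mono (leqnSn _) lrn.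
  have hB : B (l + r).+1 <= B l.
    by apply: inord_mono lrn; rewrite // -addnS leq_addr.
  have : 0 <= (B l - B (l + r).+1) * (A (l + r)%N - A (l + r).+1).
    by rewrite mulr_ge0 // subr_ge0.
  by lra.
exists (fun i => p i) => i k.
have AE (l : 'I_n.+1) : a l = A l by rewrite /A inord_val.
have BE (l : 'I_n.+1) : b l = B l by rewrite /B inord_val.
have ord_le (l : 'I_n.+1) : (l <= n)%N by rewrite -ltnS.
rewrite AE !BE; have [ik|/ltnW ki] := leqP i k.
  by have := down i (k - i)%N; rewrite subnKC //; apply.
by have := up k (i - k)%N; rewrite subnKC //; apply.
Qed.

(** Summing the dual constraints [b i * a k <= p i + q k] along [k = s i] gives
    a bound that does not depend on [s] and is attained by the identity. *)
Lemma rearrangement_inequality (R : realType) (n : nat) (a b : 'I_n -> R)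
    (a_sorted : forall i k : 'I_n, (i <= k)%N -> a k <= a i)
    (b_sorted : forall i k : 'I_n, (i <= k)%N -> b k <= b i) (s : 'S_n) :
  \sum_i b i * a (s i) <= \sum_i b i * a i.
Proof.
have [p dual] := @assignment_potential _ _ _ _ a_sorted b_sorted.
pose q k := b k * a k - p k.
have -> : \sum_i b i * a i = \sum_i p i + \sum_i q i.
  by rewrite -big_split /=; apply: eq_bigr => i _; rewrite addrC subrK.
rewrite [X in _ + X](reindex_perm s) /= -big_split /=.
by apply: ler_sum => i _; have := dual i (s i); rewrite /q; lra.
Qed.

(** * The bound for permuted combinations *)

Theorem theorem3 (R : realType) (d n : nat)
    (v : 'I_n -> 'rV[R]_d) (alpha : 'I_n -> R)
    (v_sum0 : \sum_(i < n) v i = 0)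
    (v_sorted : forall i k : 'I_n, (i <= k)%N -> enorm (v k) <= enorm (v i))
    (alpha_sorted : forall i k : 'I_n, (i <= k)%N -> alpha k <= alpha i)
    (alpha_ge0 : forall i : 'I_n, 0 <= alpha i)
    (j : nat) (j_gt0 : (0 < j)%N) (j_lt_n : (j < n)%N)
    (gamma : R)
    (gamma_bounds : alpha (ord_jth_succ j_lt_n) <= gamma <= alpha (ord_jth j_lt_n))
    (sigma : 'S_n) :
  enorm (\sum_(i < n) alpha i *: v (sigma i)) <=
    \sum_(i < n | (i < j)%N) alpha i * enorm (v i)
    - gamma / 2 * (\sum_(i < n | (i < j)%N) enorm (v i)
                   - \sum_(i < n | (j <= i)%N) enorm (v i)).
Proof.
have /andP[gamma_lo gamma_hi] := gamma_bounds.
have alpha_head (i : 'I_n) : (i < j)%N -> gamma <= alpha i.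
  move=> ij; apply: le_trans gamma_hi (alpha_sorted _ _ _) => /=.
  by rewrite -ltnS prednK.
have alpha_tail (i : 'I_n) : (j <= i)%N -> alpha i <= gamma.
  by move=> ji; apply: le_trans (alpha_sorted _ _ _) gamma_lo.
have gamma_ge0 : 0 <= gamma := le_trans (alpha_ge0 _) gamma_lo.
pose beta (i : 'I_n) := if (i < j)%N then alpha i - gamma / 2 else gamma / 2.
have beta_sorted (i k : 'I_n) : (i <= k)%N -> beta k <= beta i.
  rewrite /beta => ik; case: (ltnP k j) => [kj|jk].
    by rewrite (leq_ltn_trans ik kj) lerD2r alpha_sorted.
  by case: (ltnP i j) => [/alpha_head|_]; lra.
have shift_le_beta i : `|alpha i - gamma / 2| <= beta i.
  have := alpha_ge0 i; rewrite /beta ler_norml.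
  by case: (ltnP i j) => [/alpha_head|/alpha_tail] *; apply/andP; split; lra.
have -> : \sum_i alpha i *: v (sigma i)
    = \sum_i (alpha i - gamma / 2) *: v (sigma i).
  have vs0 : \sum_i v (sigma i) = 0.
    by rewrite -[RHS]v_sum0 [RHS](reindex_perm sigma).
  under [RHS]eq_bigr do rewrite scalerBl.
  by rewrite sumrB -scaler_sumr vs0 scaler0 subr0.
apply: le_trans (enorm_sum_scale_le _ _ _ _ _) _.
apply: (@le_trans _ _ (\sum_i beta i * enorm (v (sigma i)))).
  by apply: ler_sum => i _; rewrite ler_wpM2r ?enorm_ge0.
have := @rearrangement_inequality _ _ (fun i => enorm (v i)) _
  v_sorted beta_sorted sigma.
move/le_trans; apply.
rewrite (bigID (fun i : 'I_n => (i < j)%N)) /= mulrBr opprB addrCA.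
rewrite [leRHS]addrC !mulr_sumr -sumrB; apply: lerD.
  by apply: ler_sum => i ij; rewrite /beta ij mulrBl.
rewrite (eq_bigl (fun i : 'I_n => (j <= i)%N)); last by move=> i; rewrite -leqNgt.
by apply: ler_sum => i ji; rewrite /beta ltnNge ji.
Qed.
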